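(* Let $\tau$ be a generalized 2-nilpotent structure on a smooth manifold $M$, let $E=\mathrm{im}\,\tau$, and let $\omega\in\Gamma\wedge^2E^*$ be the associated non-degenerate $2$-form. Then $\tau$ is integrable if and only if $\tau$ is weakly integrable and $\omega$ is a symplectic form of the Lie algebroid $E$.
   Context: $M$ is a smooth manifold, $\mathbf{T}M=TM\oplus T^*M$, with neutral metric $g((X,\alpha),(Y,\mu))=\alpha(Y)+\mu(X)$ and Courant bracket $[(X,\alpha),(Y,\mu)]=([X,Y],L_X\mu-L_Y\alpha+\frac12 d(\alpha(Y)-\mu(X)))$. A generalized 2-nilpotent structure is an endomorphism $\tau\in End(\mathbf{T}M)$ of constant rank with $\tau^2=0$ and $g(\mathcal X,\tau\mathcal Y)+g(\tau\mathcal X,\mathcal Y)=0$. Its image $E=\mathrm{im}\,\tau$ is a $g$-isotropic subbundle, and $\ker\tau=E^{\perp_g}$ (the $g$-orthogonal subbundle). The associated $2$-form is $\omega(e_1,e_2)=g(e_1,\mathcal X_2)$ for $e_1,e_2\in\Gamma E$, where $\tau\mathcal X_2=e_2$; it is well defined and non-degenerate. $\tau$ is weakly integrable if $\Gamma E$ is closed under the Courant bracket; in that case $E$, with the Courant bracket and the anchor $pr_{TM}|_E$, is a Lie algebroid, with exterior differential $d_E$. $\tau$ is integrable if its Courant-Nijenhuis torsion $\mathcal N_\tau(\mathcal X,\mathcal Y)=[\tau\mathcal X,\tau\mathcal Y]-\tau[\mathcal X,\tau\mathcal Y]-\tau[\tau\mathcal X,\mathcal Y]+\tau^2[\mathcal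 X,\mathcal Y]$ vanishes for all $\mathcal X,\mathcal Y\in\Gamma\mathbf{T}M$. A symplectic form of a Lie algebroid $E$ is a non-degenerate $\omega\in\Gamma\wedge^2E^*$ with $d_E\omega=0$. *)

(* Defs.v *)
From HB Require Import structures.
From mathcomp Require Import all_boot all_order all_algebra.
From mathcomp Require Import mathcomp_extra boolp classical_sets functions.
From mathcomp Require Import cardinality reals topology normedtype derive ring.
Set Implicit Arguments.
Unset Strict Implicit.
Unset Printing Implicit Defensive.
Import Order.TTheory GRing.Theory Num.Theory.
Import numFieldNormedType.Exports.
Local Open Scope classical_set_scope.
Local Open Scope ring_scope.

Section Euclidean.
Context {R : realType} {n : nat}.
Implicit Types (U : set 'rV[R]_n) (f g h : 'rV[R]_n -> R).

Definition partial (i : 'I_n) f : 'rV[R]_n -> R :=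
  fun x => 'D_(delta_mx 0 i) f x.

(* the mixed partial derivative; the head of the list is taken first *)
Definition partials (s : seq 'I_n) f : 'rV[R]_n -> R :=
  foldl (fun h i => partial i h) f s.

(* C^oo on U, meant for U open; values of f outside U are irrelevant *)
Definition smooth_on U f :=
  forall (s : seq 'I_n) x, U x ->
    {for x, continuous (partials s f)} /\
    forall i, derivable (partials s f) x (delta_mx 0 i).

Lemma partials_eq U f g s : open U -> (forall x, U x -> f x = g x) ->
  forall x, U x -> partials s f x = partials s g x.
Proof.
move=> oU; elim: s f g => [//|i s IHs] f g fg x Ux /=.
apply: IHs => // y Uy; apply: near_eq_derive.
by apply: filterS (open_nbhs_nbhs (conj oU Uy)) => z /fg.
Qed.

Definition Ck (k : nat) U f := forall (s : seq 'I_n) x, (size s <= k)%N -> U x ->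
  {for x, continuous (partials s f)} /\
  forall i, derivable (partials s f) x (delta_mx 0 i).

Lemma smoothCk U f : (forall k, Ck k U f) -> smooth_on U f.
Proof. by move=> Cf s x; apply: (Cf (size s)). Qed.

Lemma CkW k U f : Ck k.+1 U f -> Ck k U f.
Proof. by move=> Cf s x sk; apply: Cf; exact: leqW. Qed.

Lemma CkS k U f i : Ck k.+1 U f -> Ck k U (partial i f).
Proof. by move=> Cf s x sk; apply: (Cf (i :: s)). Qed.

Lemma CkP k U f : Ck 0 U f -> (forall i, Ck k U (partial i f)) -> Ck k.+1 U f.
Proof. by move=> C0f Cf [|i s] x /= sk; [exact: (C0f [::])|exact: Cf]. Qed.

Lemma Ck_eq k U f g : open U -> (forall x, U x -> f x = g x) ->
  Ck k U f -> Ck k U g.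
Proof.
move=> oU fg Cf s x sk Ux; have [cf df] := Cf s x sk Ux.
have nfg : {near x, partials s f =1 partials s g}.
  apply: filterS (open_nbhs_nbhs (conj oU Ux)) => z Uz.
  exact: (partials_eq s oU fg).
split=> [|i]; last exact (near_eq_derivable nfg (df i)).
rewrite /prop_for /continuous_at -(partials_eq s oU fg Ux).
by apply: cvg_trans cf; exact (near_eq_cvg nfg).
Qed.

Lemma CkD k U f g : open U -> Ck k U f -> Ck k U g -> Ck k U (f + g).
Proof.
move=> oU; have C0 h1 h2 : Ck 0 U h1 -> Ck 0 U h2 -> Ck 0 U (h1 + h2).
  move=> C1 C2 [|//] x _ Ux /=.
  have [[c1 d1] [c2 d2]] := (C1 [::] x erefl Ux, C2 [::] x erefl Ux).
  by split=> [|i]; [exact: continuousD|exact: derivableD].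
elim: k f g => [//|k IHk] f g Cf Cg; apply: CkP.
  by apply: C0 => s x s0; [apply: Cf|apply: Cg]; exact: leq_trans s0 _.
move=> i; apply: (@Ck_eq _ _ (partial i f + partial i g)) => //.
  move=> x Ux; rewrite /partial deriveD//.
  - by have [_] := Cf [::] x erefl Ux; exact.
  - by have [_] := Cg [::] x erefl Ux; exact.
by apply: IHk; exact: CkS.
Qed.

Lemma CkM k U f g : open U -> Ck k U f -> Ck k U g -> Ck k U (f * g).
Proof.
move=> oU; have C0 h1 h2 : Ck 0 U h1 -> Ck 0 U h2 -> Ck 0 U (h1 * h2).
  move=> C1 C2 [|//] x _ Ux /=.
  have [[c1 d1] [c2 d2]] := (C1 [::] x erefl Ux, C2 [::] x erefl Ux).
  by split=> [|i]; [exact: continuousM|exact: derivableM].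
elim: k f g => [//|k IHk] f g Cf Cg; apply: CkP.
  by apply: C0 => s x s0; [apply: Cf|apply: Cg]; exact: leq_trans s0 _.
move=> i; apply: (@Ck_eq _ _ (f * partial i g + g * partial i f)) => //.
  move=> x Ux; rewrite /partial deriveM//.
  - by have [_] := Cf [::] x erefl Ux; exact.
  - by have [_] := Cg [::] x erefl Ux; exact.
by apply: CkD => //; apply: IHk; do ?[exact: CkS|exact: CkW].
Qed.

Lemma smooth_on_cst U (c : R) : smooth_on U (cst c).
Proof.
move=> s x _; have [d ->] : exists d, partials s (cst c) = cst d.
  elim: s c => [|i s IHs] c; first by exists c.
  have -> : partials (i :: s) (cst c) = partials s (cst 0).
    by congr (partials s _); apply/funext => y; rewrite /partial derive_cst.
  exact: IHs.
by split=> [|i]; [exact: cst_continuous|exact: derivable_cst].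
Qed.

Lemma smooth_onD U f g : open U ->
  smooth_on U f -> smooth_on U g -> smooth_on U (f + g).
Proof.
move=> oU sf sg; apply: smoothCk => k.
by apply: CkD => // s x _; [exact: sf|exact: sg].
Qed.

Lemma smooth_onM U f g : open U ->
  smooth_on U f -> smooth_on U g -> smooth_on U (f * g).
Proof.
move=> oU sf sg; apply: smoothCk => k.
by apply: CkM => // s x _; [exact: sf|exact: sg].
Qed.
End Euclidean.

Record chart (R : realType) (n : nat) (T : topologicalType) := Chart {
  chart_dom : set T;
  coord : T -> 'rV[R]_n;
  coord_inv : 'rV[R]_n -> T;
  chart_open : open chart_dom;
  chart_im_open : open (coord @` chart_dom);
  coordK : forall p, chart_dom p -> coord_inv (coord p) = p;
  coord_continuous : forall p, chart_dom p -> {for p, continuous coord};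
  coord_inv_continuous : forall x, (coord @` chart_dom) x ->
    {for x, continuous coord_inv} }.

Definition chart_im R n T (c : chart R n T) : set 'rV[R]_n :=
  coord c @` chart_dom c.

Definition chart_compatible R n T (c d : chart R n T) :=
  forall i : 'I_n, smooth_on (coord c @` (chart_dom c `&` chart_dom d))
    (fun x => coord d (coord_inv c x) 0 i).

(* The atlas need not be maximal. *)
Record manifold (R : realType) (n : nat) := Manifold {
  carrier :> topologicalType;
  manifold_hausdorff : hausdorff_space carrier;
  manifold_second_countable : @second_countable carrier;
  atlas : set (chart R n carrier);
  atlas_cover : forall p, exists2 c, atlas c & chart_dom c p;
  atlas_compatible : forall c d, atlas c -> atlas d -> chart_compatible c d }.

Section SmoothFunctions.
Context {R : realType} {n : nat} (M : manifold R n).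

Definition smooth_pred : {pred (M -> R)} := fun f => `[< forall c, atlas c ->
  smooth_on (chart_im c) (f \o coord_inv c) >].

Record smooth := Smooth { smooth_fun :> M -> R; _ : smooth_fun \in smooth_pred }.

HB.instance Definition _ := [isSub for smooth_fun].
HB.instance Definition _ := [Choice of smooth by <:].

Fact smooth_cst c : cst c \in smooth_pred.
Proof. by apply/asboolP => d _; exact: smooth_on_cst. Qed.

Definition const (c : R) : smooth := Smooth (smooth_cst c).

Fact smooth_subring : subring_closed smooth_pred.
Proof.
have sM : {in smooth_pred &, forall f g, f * g \in smooth_pred}.
  move=> f g /asboolP sf /asboolP sg; apply/asboolP => c ac.
  exact (smooth_onM (@chart_im_open _ _ _ c) (sf c ac) (sg c ac)).
split; [exact (smooth_cst 1) | | exact sM].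
move=> f g sf sg; have sNg : - g \in smooth_pred.
  have -> : - g = cst (-1) * g by apply/funext => x; rewrite !fctE/= mulN1r.
  exact (sM _ _ (smooth_cst (-1)) sg).
move: sf sNg => /asboolP sf /asboolP sg'; apply/asboolP => c ac.
exact (smooth_onD (@chart_im_open _ _ _ c) (sf c ac) (sg' c ac)).
Qed.
HB.instance Definition _ :=
  GRing.isSubringClosed.Build (M -> R) smooth_pred smooth_subring.
HB.instance Definition _ := 
  GRing.SubChoice_isSubComPzRing.Build (M -> R) smooth_pred smooth
    (subringClosedP _).

End SmoothFunctions.

Lemma smoothP {R : realType} {n : nat} {M : manifold R n} (f g : smooth M) :
  (forall p, f p = g p) -> f = g.
Proof. by move=> fg; apply/val_inj/funext. Qed.

Section Calculus.
Context {R : realType} {n : nat} (M : manifold R n).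
Implicit Types (f g h : smooth M) (c : R).

(* Vector fields as R-linear derivations of C^oo(M); the real c acts as the
   constant function const c. *)
Record vector_field := VectorField {
  vf :> smooth M -> smooth M;
  vfD : forall f g, vf (f + g) = vf f + vf g;
  vfZ : forall c f, vf (const M c * f) = const M c * vf f;
  vfM : forall f g, vf (f * g) = vf f * g + f * vf g }.

Lemma vector_fieldP (X Y : vector_field) : (forall f, X f = Y f) -> X = Y.
Proof.
case: X Y => [X ? ? ?] [Y ? ? ?] /= XY; have E : X = Y by apply/funext.
by subst Y; congr VectorField; exact: Prop_irrelevance.
Qed.

HB.instance Definition _ := gen_eqMixin vector_field.
HB.instance Definition _ := gen_choiceMixin vector_field.

Implicit Types X Y Z : vector_field.

Lemma vf0 X : X 0 = 0.
Proof. by apply: (addrI (X 0)); rewrite -vfD !addr0. Qed.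

Lemma vfN X f : X (- f) = - X f.
Proof. by apply: (addrI (X f)); rewrite -vfD !subrr vf0. Qed.

Lemma vfB X f g : X (f - g) = X f - X g.
Proof. by rewrite vfD vfN. Qed.

Lemma vf_const X c : X (const M c) = 0.
Proof.
have := vfM X (const M c) 1; rewrite vfZ !mulr1 => /eqP.
by rewrite -subr_eq subrr => /eqP.
Qed.

Definition vf_zero : vector_field.
Proof. by exists (fun=> 0) => *; ring. Defined.

Definition vf_opp X : vector_field.
Proof. by exists (fun f => - X f) => *; rewrite ?vfD ?vfZ ?vfM; ring. Defined.

Definition vf_add X Y : vector_field.
Proof.
by exists (fun f => X f + Y f) => *; rewrite ?vfD ?vfZ ?vfM; ring.
Defined.

Definition vf_scale h X : vector_field.
Proof. by exists (fun f => h * X f) => *; rewrite ?vfD ?vfZ ?vfM; ring. Defined.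

Fact vf_addA : associative vf_add.
Proof. by move=> X Y Z; apply: vector_fieldP => f /=; rewrite addrA. Qed.
Fact vf_addC : commutative vf_add.
Proof. by move=> X Y; apply: vector_fieldP => f /=; rewrite addrC. Qed.
Fact vf_add0 : left_id vf_zero vf_add.
Proof. by move=> X; apply: vector_fieldP => f /=; rewrite add0r. Qed.
Fact vf_addN : left_inverse vf_zero vf_opp vf_add.
Proof. by move=> X; apply: vector_fieldP => f /=; rewrite addNr. Qed.
HB.instance Definition _ :=
  GRing.isZmodule.Build vector_field vf_addA vf_addC vf_add0 vf_addN.

Fact vf_scaleA g h X : vf_scale g (vf_scale h X) = vf_scale (g * h) X.
Proof. by apply: vector_fieldP => f /=; rewrite mulrA. Qed.
Fact vf_scale1 : left_id 1 vf_scale.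
Proof. by move=> X; apply: vector_fieldP => f /=; rewrite mul1r. Qed.
Fact vf_scaleDr : right_distributive vf_scale +%R.
Proof. by move=> h X Y; apply: vector_fieldP => f /=; rewrite mulrDr. Qed.
Fact vf_scaleDl X : {morph vf_scale^~ X : g h / g + h}.
Proof. by move=> g h; apply: vector_fieldP => f /=; rewrite mulrDl. Qed.
HB.instance Definition _ := GRing.Zmodule_isLmodule.Build (smooth M)
  vector_field vf_scaleA vf_scale1 vf_scaleDr vf_scaleDl.

(* 1-forms as C^oo(M)-linear maps from vector fields to functions *)
Record one_form := OneForm {
  form :> vector_field -> smooth M;
  formD : forall X Y, form (X + Y) = form X + form Y;
  formZ : forall f X, form (f *: X) = f * form X }.

Implicit Types al mu : one_form.

Lemma one_formP al mu : (forall X, al X = mu X) -> al = mu.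
Proof.
case: al mu => [al ? ?] [mu ? ?] /= am; have E : al = mu by apply/funext.
by subst mu; congr OneForm; exact: Prop_irrelevance.
Qed.

HB.instance Definition _ := gen_eqMixin one_form.
HB.instance Definition _ := gen_choiceMixin one_form.

Lemma form0 al : al 0 = 0.
Proof. by apply: (addrI (al 0)); rewrite -formD !addr0. Qed.

Lemma formN al X : al (- X) = - al X.
Proof. by apply: (addrI (al X)); rewrite -formD !subrr form0. Qed.

Lemma formB al X Y : al (X - Y) = al X - al Y.
Proof. by rewrite formD formN. Qed.

Definition form_zero : one_form.
Proof. by exists (fun=> 0) => *; ring. Defined.

Definition form_opp al : one_form.
Proof. by exists (fun X => - al X) => *; rewrite ?formD ?formZ; ring. Defined.

Definition form_add al mu : one_form.
Proof.
by exists (fun X => al X + mu X) => *; rewrite ?formD ?formZ; ring.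
Defined.

Definition form_scale h al : one_form.
Proof. by exists (fun X => h * al X) => *; rewrite ?formD ?formZ; ring. Defined.

Fact form_addA : associative form_add.
Proof. by move=> a b d; apply: one_formP => X /=; rewrite addrA. Qed.
Fact form_addC : commutative form_add.
Proof. by move=> a b; apply: one_formP => X /=; rewrite addrC. Qed.
Fact form_add0 : left_id form_zero form_add.
Proof. by move=> a; apply: one_formP => X /=; rewrite add0r. Qed.
Fact form_addN : left_inverse form_zero form_opp form_add.
Proof. by move=> a; apply: one_formP => X /=; rewrite addNr. Qed.
HB.instance Definition _ :=
  GRing.isZmodule.Build one_form form_addA form_addC form_add0 form_addN.

Fact form_scaleA g h al : form_scale g (form_scale h al) = form_scale (g * h) al.
Proof. by apply: one_formP => X /=; rewrite mulrA. Qed.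
Fact form_scale1 : left_id 1 form_scale.
Proof. by move=> a; apply: one_formP => X /=; rewrite mul1r. Qed.
Fact form_scaleDr : right_distributive form_scale +%R.
Proof. by move=> h a b; apply: one_formP => X /=; rewrite mulrDr. Qed.
Fact form_scaleDl al : {morph form_scale^~ al : g h / g + h}.
Proof. by move=> g h; apply: one_formP => X /=; rewrite mulrDl. Qed.
HB.instance Definition _ := GRing.Zmodule_isLmodule.Build (smooth M)
  one_form form_scaleA form_scale1 form_scaleDr form_scaleDl.

Definition lie_bracket X Y : vector_field.
Proof.
exists (fun f => X (Y f) - Y (X f)) => *.
- by rewrite !vfD; ring.
- by rewrite !vfZ; ring.
- by rewrite !(vfM, vfD); ring.
Defined.

Lemma lie_bracketD X Y Z :
  lie_bracket X (Y + Z) = lie_bracket X Y + lie_bracket X Z.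
Proof. by apply: vector_fieldP => h /=; rewrite vfD; ring. Qed.

Lemma lie_bracketZ X f Y :
  lie_bracket X (f *: Y) = f *: lie_bracket X Y + X f *: Y.
Proof. by apply: vector_fieldP => h /=; rewrite vfM; ring. Qed.

Lemma lie_bracketC X Y : lie_bracket X Y = - lie_bracket Y X.
Proof. by apply: vector_fieldP => h /=; ring. Qed.

Lemma lie_bracketDl X Y Z :
  lie_bracket (X + Y) Z = lie_bracket X Z + lie_bracket Y Z.
Proof. by apply: vector_fieldP => h /=; rewrite vfD; ring. Qed.

Lemma lie_bracketZl f X Y :
  lie_bracket (f *: X) Y = f *: lie_bracket X Y - Y f *: X.
Proof. by apply: vector_fieldP => h /=; rewrite vfM; ring. Qed.

Lemma lie_jacobi X Y Z : lie_bracket (lie_bracket X Y) Z =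
  lie_bracket X (lie_bracket Y Z) - lie_bracket Y (lie_bracket X Z).
Proof. by apply: vector_fieldP => h /=; rewrite !vfB; ring. Qed.

Definition lie_derivative X mu : one_form.
Proof.
exists (fun Y => X (mu Y) - mu (lie_bracket X Y)) => *.
- by rewrite lie_bracketD !formD vfD; ring.
- by rewrite lie_bracketZ formD !formZ vfM; ring.
Defined.

Definition differential f : one_form.
Proof. by exists (fun X => X f). Defined.

(* the sections of TM (+) T*M *)
Definition section : Type := (vector_field * one_form)%type.
HB.instance Definition _ := GRing.Lmodule.on section.

Implicit Types S T W : section.

Definition metric S T : smooth M := S.2 T.1 + T.2 S.1.

Definition courant S T : section :=
  (lie_bracket S.1 T.1,
   lie_derivative S.1 T.2 - lie_derivative T.1 S.2 +
     const M 2^-1 *: differential (S.2 T.1 - T.2 S.1)).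

(* The value of S = (X, al) at p is zero: al_p = 0 is tested on all vector
   fields, and X_p = 0 on all 1-forms, in particular on all df. *)
Definition vanishes_at (p : M) S :=
  (forall mu : one_form, mu S.1 p = 0) /\ (forall Y, S.2 Y p = 0).

(* An endomorphism of the bundle TM (+) T*M is a C^oo(M)-linear map of its
   sections. Its rank at p is k: the space of all values (tau T)_p has a
   basis over R with k elements. *)
Definition rank_at (tau : {linear section -> section}) (p : M) (k : nat) :=
  exists B : 'I_k -> section,
    (forall c : 'I_k -> R,
       vanishes_at p (\sum_i const M (c i) *: tau (B i)) ->
       forall i, c i = 0) /\
    (forall T, exists c : 'I_k -> R,
       vanishes_at p (tau T - \sum_i const M (c i) *: tau (B i))).

Record two_nilpotent := TwoNilpotent {
  tau :> {linear section -> section};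
  tau_rank : exists k, forall p, rank_at tau p k;
  tau_square : forall S, tau (tau S) = 0;
  tau_skew : forall S T, metric S (tau T) + metric (tau S) T = 0 }.

Definition torsion (t : {linear section -> section}) S T : section :=
  courant (t S) (t T) - t (courant S (t T)) - t (courant (t S) T)
  + t (t (courant S T)).

Definition integrable (t : two_nilpotent) := forall S T, torsion t S T = 0.

(* sections of E = im tau: S_p belongs to im tau_p for every p *)
Definition im_pred (t : two_nilpotent) : {pred section} :=
  fun S => `[< forall p, exists T, vanishes_at p (S - t T) >].

Definition weakly_integrable (t : two_nilpotent) := forall S T,
  S \in im_pred t -> T \in im_pred t -> courant S T \in im_pred t.

(* Lie algebroids, through their C^oo(M)-module of sections *)
Record lie_algebroid := LieAlgebroid {
  la_sections :> lmodType (smooth M);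
  la_bracket : la_sections -> la_sections -> la_sections;
  la_anchor : {linear la_sections -> vector_field};
  la_bracketD : forall a b d,
    la_bracket a (b + d) = la_bracket a b + la_bracket a d;
  la_bracketC : forall a b, la_bracket a b = - la_bracket b a;
  la_jacobi : forall a b d, la_bracket (la_bracket a b) d =
    la_bracket a (la_bracket b d) - la_bracket b (la_bracket a d);
  la_leibniz : forall a f b, la_bracket a (f *: b) =
    f *: la_bracket a b + la_anchor a f *: b;
  la_anchor_bracket : forall a b,
    la_anchor (la_bracket a b) = lie_bracket (la_anchor a) (la_anchor b) }.

Record two_form (L : lmodType (smooth M)) := TwoForm {
  two_form_fun :> L -> L -> smooth M;
  two_formD : forall a b d,
    two_form_fun a (b + d) = two_form_fun a b + two_form_fun a d;
  two_formZ : forall a f b, two_form_fun a (f *: b) = f * two_form_fun a b;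
  two_formC : forall a b, two_form_fun a b = - two_form_fun b a }.

(* d_A omega (a, b, d) for a Lie algebroid A *)
Definition la_differential (A : lie_algebroid) (om : two_form A) (a b d : A) :
    smooth M :=
  la_anchor A a (om b d) - la_anchor A b (om a d) + la_anchor A d (om a b)
  - om (la_bracket a b) d + om (la_bracket a d) b - om (la_bracket b d) a.
End Calculus.

Section Image.
Context {R : realType} {n : nat} {M : manifold R n}.
Implicit Types (f g h : smooth M) (X Y Z : vector_field M).
Implicit Types (S T W : section M) (t : two_nilpotent M).

Lemma metricC S T : metric S T = metric T S.
Proof. by rewrite /metric addrC. Qed.

Lemma metricDl S T W : metric (S + T) W = metric S W + metric T W.
Proof. by rewrite /metric /= formD; ring. Qed.

Lemma metricZl f S T : metric (f *: S) T = f * metric S T.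
Proof. by rewrite /metric /= formZ; ring. Qed.

Lemma metricBl S T W : metric (S - T) W = metric S W - metric T W.
Proof. by rewrite -scaleN1r metricDl metricZl mulN1r. Qed.

Lemma vanishes_atP p S :
  vanishes_at p S <-> forall W, metric S W p = 0.
Proof.
split=> [[S1 S2] W|S0].
  by rewrite /metric -[LHS]/(S.2 W.1 p + W.2 S.1 p) S1 S2 addr0.
split=> [mu|Y].
  by have := S0 (0, mu); rewrite /metric /= form0 add0r.
by have := S0 (Y, 0); rewrite /metric /= addr0.
Qed.

Lemma tau_metric t S T : metric (t S) T = - metric S (t T).
Proof. by apply/eqP; rewrite -addr_eq0 addrC tau_skew. Qed.

Fact im_submod t : submod_closed (im_pred t).
Proof.
split=> [|f S T /asboolP iS /asboolP iT]; apply/asboolP => p.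
  exists 0; apply/vanishes_atP => W.
  by rewrite linear0 subrr -(scale0r 0) metricZl mul0r.
have [[S' vS] [T' vT]] := (iS p, iT p); exists (f *: S' + T').
apply/vanishes_atP => W; rewrite linearP.
have -> : f *: S + T - (f *: t S' + t T') = f *: (S - t S') + (T - t T').
  by rewrite scalerBr opprD addrACA.
rewrite metricDl metricZl; move/vanishes_atP : vS => /(_ W) vS.
move/vanishes_atP : vT => /(_ W) vT.
by rewrite -[LHS]/(f p * metric (S - t S') W p + metric (T - t T') W p)
  vS vT mulr0 addr0.
Qed.
HB.instance Definition _ t :=
  GRing.isSubmodClosed.Build (smooth M) (section M) (im_pred t) (im_submod t).

(* the C^oo(M)-module of sections of E = im t *)
Record im_sections t := ImSection {
  im_val :> section M; _ : im_val \in im_pred t }.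
HB.instance Definition _ t := [isSub for @im_val t].
HB.instance Definition _ t := [Choice of im_sections t by <:].
HB.instance Definition _ t := [SubChoice_isSubLmodule of im_sections t by <:].

Lemma im_isotropic t (a b : im_sections t) : metric a b = 0.
Proof.
apply: smoothP => p.
have /asboolP/(_ p)[S] := valP a; have /asboolP/(_ p)[T] := valP b.
move=> /vanishes_atP vT /vanishes_atP vS.
have -> : metric a b = metric (val a - t S) b + metric (t S) b.
  by rewrite -metricDl subrK.
rewrite -[LHS]/(metric (val a - t S) b p + metric (t S) b p) vS add0r.
have -> : metric (t S) b = metric (val b - t T) (t S).
  rewrite metricBl [X in _ - X]tau_metric tau_square.
  by rewrite metricC /metric /= form0 addr0 oppr0 subr0.
exact: vT.
Qed.

Lemma const_half f : const M 2^-1 * (f + f) = f.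
Proof.
apply: smoothP => p; rewrite -[LHS]/(2^-1 * (f p + f p)).
by field.
Qed.

Lemma im_alt t (a b : im_sections t) :
  (val a).2 (val b).1 = - (val b).2 (val a).1.
Proof. by apply/eqP; rewrite -addr_eq0; apply/eqP/im_isotropic. Qed.

Lemma courant_im1 S T : (courant S T).1 = lie_bracket S.1 T.1.
Proof. by []. Qed.

Lemma courant_im2 t (a b : im_sections t) Z :
  (courant (val a) (val b)).2 Z =
  (val a).1 ((val b).2 Z) - (val b).2 (lie_bracket (val a).1 Z)
  - (val b).1 ((val a).2 Z) + (val a).2 (lie_bracket (val b).1 Z)
  + Z ((val a).2 (val b).1).
Proof.
rewrite -[LHS]/((val a).1 ((val b).2 Z) - (val b).2 (lie_bracket (val a).1 Z)
  - ((val b).1 ((val a).2 Z) - (val a).2 (lie_bracket (val b).1 Z))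
  + const M 2^-1 * Z ((val a).2 (val b).1 - (val b).2 (val a).1)).
rewrite -[in X in _ + const M _ * X](opprK ((val b).2 (val a).1)) -im_alt.
rewrite opprK vfD const_half; ring.
Qed.

Section WeaklyIntegrable.
Context {t : two_nilpotent M} (wt : weakly_integrable t).
Implicit Types a b d : im_sections t.

Definition im_bracket a b : im_sections t :=
  ImSection (wt (valP a) (valP b)).

Definition im_anchor a : vector_field M := (val a).1.

Fact im_anchor_linear : linear im_anchor.
Proof. by []. Qed.
HB.instance Definition _ := GRing.isLinear.Build (smooth M) (im_sections t)
  (vector_field M) *:%R im_anchor im_anchor_linear.

Fact im_bracketP a b : (val a).1 = (val b).1 ->
  (forall Z, (val a).2 Z = (val b).2 Z) -> a = b.
Proof.
move=> ab1 ab2; apply/val_inj; rewrite [LHS]surjective_pairing.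
by rewrite [RHS]surjective_pairing ab1; congr (_, _); exact: one_formP.
Qed.

Fact im_bracketD a b d :
  im_bracket a (b + d) = im_bracket a b + im_bracket a d.
Proof.
apply: im_bracketP => [|Z]; first exact: lie_bracketD.
rewrite -[RHS]/((courant (val a) (val b)).2 Z + (courant (val a) (val d)).2 Z).
rewrite !courant_im2.
have E1 : (val (b + d)).1 = (val b).1 + (val d).1 by [].
have E2 V : (val (b + d)).2 V = (val b).2 V + (val d).2 V by [].
have E3 f : ((val b).1 + (val d).1) f = (val b).1 f + (val d).1 f by [].
rewrite E1 !E2 E3 !lie_bracketDl !formD !vfD; ring.
Qed.

Fact im_bracketC a b : im_bracket a b = - im_bracket b a.
Proof.
apply: im_bracketP => [|Z]; first exact: lie_bracketC.
rewrite -[RHS]/(- (courant (val b) (val a)).2 Z) !courant_im2 im_alt vfN; ring.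
Qed.

Fact im_jacobi a b d : im_bracket (im_bracket a b) d =
  im_bracket a (im_bracket b d) - im_bracket b (im_bracket a d).
Proof.
apply: im_bracketP => [|Z]; first exact: lie_jacobi.
rewrite -[RHS]/((courant (val a) (val (im_bracket b d))).2 Z -
  (courant (val b) (val (im_bracket a d))).2 Z).
rewrite !courant_im2.
have E1 (a' b' : im_sections t) :
  (val (im_bracket a' b')).1 = lie_bracket (val a').1 (val b').1 by [].
have E2 X Y f : lie_bracket X Y f = X (Y f) - Y (X f) by [].
rewrite !E1 !lie_jacobi !formB !E2 !(vfB, vfD); ring.
Qed.

Fact im_leibniz a f b : im_bracket a (f *: b) =
  f *: im_bracket a b + im_anchor a f *: b.
Proof.
apply: im_bracketP => [|Z]; first exact: lie_bracketZ.
rewrite -[RHS]/(f * (courant (val a) (val b)).2 Z +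
  (val a).1 f * (val b).2 Z) !courant_im2.
have E1 : (val (f *: b)).1 = f *: (val b).1 by [].
have E2 V : (val (f *: b)).2 V = f * (val b).2 V by [].
have E3 h : (f *: (val b).1) h = f * (val b).1 h by [].
rewrite E1 !E2 E3 lie_bracketZl formB !formZ !vfM; ring.
Qed.

Definition im_algebroid : lie_algebroid M :=
  LieAlgebroid im_bracketD im_bracketC im_jacobi im_leibniz
    (fun a b => erefl (lie_bracket (val a).1 (val b).1)).

End WeaklyIntegrable.

Definition associated_form t (om : two_form (im_sections t)) :=
  forall (a b : im_sections t) T, t T = val b -> om a b = metric (val a) T.

(* pointwise: om_p is non-degenerate on the fibre E_p = {a_p} *)
Definition nondegenerate t (om : two_form (im_sections t)) :=
  forall (p : M) (a : im_sections t),
    (forall b, om a b p = 0) -> vanishes_at p (val a).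

Definition symplectic_form t (wt : weakly_integrable t)
    (om : two_form (im_sections t)) :=
  nondegenerate om /\
  forall a b d, @la_differential R n M (im_algebroid wt) om a b d = 0.

End Image.

(* Main.v *)
From HB Require Import structures.
From mathcomp Require Import all_boot all_algebra boolp reals topology ring.
Require Import Defs.
(** The proof has an algebraic core and a localization argument.

    The core is the identity of [torsion_differential]: on sections of the
    form tau S, tau T, tau W,
      g(N(S, T), W) = - (d_E omega)(tau S, tau T, tau W).
    Skewness of tau moves the outer tau of each term of N onto W. The mixed
    terms g([S, tau T], tau W) and g([tau S, T], tau W) are then rewritten by
    the invariance of g under the Courant bracket ([courant_metric]). Since
    E is isotropic, its correction terms survive only through
    omega(tau S, tau T) = g(tau S, T); the two halves left over add up to the
    missing third derivative in the Cartan formula for d_E omega. As g is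
    non-degenerate ([metric_inj]), N vanishes if and only if d_E omega
    vanishes on the image of tau acting on global sections.

    The localization argument is needed because a section S of E is only
    pointwise in the image of tau, whereas both the torsion and omega are
    controlled on sections tau T. Constant rank supplies, for every point p,
    a global function f with f(p) <> 0 such that f S = tau T for a global T
    ([im_local_preimage]). The function f is a squared Gram determinant and T
    comes from Cramer's rule, so that no bump function is required.
    Together with the Leibniz rule of the Courant bracket on isotropic pairs,
    this spreads closure under the bracket from the sections tau S to all
    sections of E ([weakly_integrable_im]); together with tensoriality of
    d_E omega, it spreads the vanishing of d_E omega ([tau_differential0]).
    Non-degeneracy of omega follows from that of g, because
    omega(a, tau W) = g(a, W) for every W. *)

Import GRing.Theory.
Local Open Scope ring_scope.

(** * Independent functions and determinants *)

(** By induction on [k]: the determinant, expanded along the column of one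
    further point y, is a linear combination of the [f i y] in which the
    coefficient of the first function is the determinant already known to be
    non-zero. Independence provides a y where this combination does not
    vanish. *)
Lemma independent_functions_det (F : fieldType) (T : Type) (k : nat)
    (f : 'I_k -> T -> F) :
  (forall c : 'I_k -> F, (forall x, \sum_i c i * f i x = 0) ->
    forall i, c i = 0) ->
  exists x : 'I_k -> T, \det (\matrix_(i, j) f i (x j)) != 0.
Proof.
elim: k f => [|k IHk] f free_f.
  exists (fun i : 'I_0 => False_rect T (notF (ltn_ord i))).
  by rewrite det_mx00 oner_neq0.
have [|x det_x] := IHk (fun i => f (lift ord0 i)).
  move=> c c0 i; have := free_f (fun i => oapp c 0 (unlift ord0 i)).
  move=> /(_ _ (lift ord0 i)); rewrite liftK /=; apply=> y.
  rewrite big_ord_recl unlift_none /= mul0r add0r -[RHS](c0 y).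
  by apply: eq_bigr => j _; rewrite liftK.
pose A y : 'M[F]_k.+1 :=
  \matrix_(i, j) f i (if unlift ord0 j is Some j' then x j' else y).
have row'A y i : row' i (col' ord0 (A y)) =
    \matrix_(i', j) f (lift i i') (x j).
  by apply/matrixP => i' j; rewrite !mxE liftK.
pose c (i : 'I_k.+1) := (-1) ^+ (i + @ord0 k) *
  \det (\matrix_(i', j) f (lift i i') (x j)).
have detA y : \det (A y) = \sum_i c i * f i y.
  rewrite (expand_det_col _ ord0); apply: eq_bigr => i _.
  by rewrite /cofactor row'A mulrC !mxE unlift_none.
have c0 : c ord0 != 0 by rewrite /c addn0 expr0 mul1r.
have [y Ay] : exists y, \det (A y) != 0.
  apply: contrapT => noy; move/eqP: c0; apply.
  apply: free_f => y; rewrite -detA.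
  by apply/eqP; apply: contrapT => /negP Ay; apply: noy; exists y.
exists (fun j => if unlift ord0 j is Some j' then x j' else y).
exact: Ay.
Qed.

(** * The metric, pointwise and globally *)

Section GeneralizedNilpotent.
Context {R : realType} {n : nat} {M : manifold R n}.
Implicit Types (f g h : smooth M) (p q : M) (S T W : section M).
Implicit Types (t : two_nilpotent M).

(** Evaluation at a point, named so that it can carry the ring morphism
    structure with which determinants of matrices of functions are evaluated
    entrywise. *)
Definition eval p f : R := f p.

Fact eval_zmod p : zmod_morphism (eval p).
Proof. by []. Qed.
HB.instance Definition _ p :=
  GRing.isZmodMorphism.Build (smooth M) R (eval p) (eval_zmod p).
Fact eval_monoid p : monoid_morphism (eval p).
Proof. by []. Qed.
HB.instance Definition _ p :=
  GRing.isMonoidMorphism.Build (smooth M) R (eval p) (eval_monoid p).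

Lemma metric0l W : metric 0 W = 0.
Proof. by rewrite -(scale0r (0 : section M)) metricZl mul0r. Qed.

Lemma metricNl S W : metric (- S) W = - metric S W.
Proof. by rewrite -sub0r metricBl metric0l sub0r. Qed.

Lemma metric_suml k (c : 'I_k -> smooth M) (S : 'I_k -> section M) W :
  metric (\sum_i c i *: S i) W = \sum_i c i * metric (S i) W.
Proof.
rewrite (big_morph (fun S => metric S W) (fun S T => metricDl S T W)
  (metric0l W)).
by apply: eq_bigr => i _; rewrite metricZl.
Qed.

(** A derivation is determined by its values on functions, that is, by the
    pairing with the exact forms. *)
Lemma vanishes_everywhere S : (forall p, vanishes_at p S) -> S = 0.
Proof.
case: S => X al S0; congr (_, _).
  apply: vector_fieldP => f; apply: smoothP => p.
  by have [/(_ (differential f))] := S0 p.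
by apply: one_formP => Y; apply: smoothP => p; have [_ /(_ Y)] := S0 p.
Qed.

Lemma metric_inj S T : (forall W, metric S W = metric T W) -> S = T.
Proof.
move=> ST; apply/eqP; rewrite -subr_eq0; apply/eqP/vanishes_everywhere => p.
by apply/vanishes_atP => W; rewrite metricBl ST subrr.
Qed.

Lemma metric_const_sum k (c : 'I_k -> R) (S : 'I_k -> section M) W p :
  metric (\sum_i const M (c i) *: S i) W p = \sum_i c i * metric (S i) W p.
Proof.
rewrite metric_suml -[LHS]/(eval p _) rmorph_sum.
by apply: eq_bigr => i _; rewrite rmorphM.
Qed.

(** * Sections of the image are locally images of global sections *)

Definition gram {k} (S W : 'I_k -> section M) : 'M[smooth M]_k :=
  \matrix_(i, j) metric (S i) (W j).

(** The pairings with all sections detect vanishing at a point, so sections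
    independent at p are independent as functions of the second argument of
    the metric at p. *)
Lemma independent_gram k (S : 'I_k -> section M) p :
  (forall c : 'I_k -> R,
     vanishes_at p (\sum_i const M (c i) *: S i) -> forall i, c i = 0) ->
  exists W : 'I_k -> section M, \det (gram S W) p != 0.
Proof.
move=> free_S.
have [|W detW] := @independent_functions_det R _ k
    (fun i W => metric (S i) W p).
  move=> c c0; apply: free_S; apply/vanishes_atP => W.
  by rewrite metric_const_sum c0.
exists W; rewrite -[_ p]/(eval p _) -det_map_mx.
by congr (\det _ != 0) : detW; apply/matrixP => i j; rewrite !mxE.
Qed.

(** Where a Gram determinant of [k] sections [t (B i)] is non-zero, they
    are independent, and since [k] is the rank of [t] there, they span the
    fibre of the image. The coordinates are read off against the basis [t (C i)]
    provided by [rank_at], by inverting the matrix [Pm] that expresses the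
    [t (B i)] in it. *)
Lemma coordinates_in_independent t k p (B W : 'I_k -> section M) S T :
  rank_at t p k -> \det (gram (t \o B) W) p != 0 ->
  vanishes_at p (S - t T) ->
  exists x : 'I_k -> R, forall V,
    metric S V p = \sum_i x i * metric (t (B i)) V p.
Proof.
move=> [C [_ spanC]] detG /vanishes_atP vST.
have {}spanC U : exists c : 'I_k -> R, forall V,
    metric (t U) V p = \sum_i c i * metric (t (C i)) V p.
  have [c /vanishes_atP vc] := spanC U; exists c => V.
  apply/eqP; rewrite -subr_eq0 -metric_const_sum; apply/eqP.
  by have := vc V; rewrite metricBl.
have [P BC] := choice (fun i => spanC (B i)).
have [y TC] := spanC T.
pose Pm : 'M[R]_k := \matrix_(i, j) P i j.
have uP : Pm \in unitmx.
  rewrite unitmxE unitfE; apply: contraNneq detG => detP.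
  rewrite -[_ p]/(eval p _) -det_map_mx.
  have -> : map_mx (eval p) (gram (t \o B) W) =
      Pm *m map_mx (eval p) (gram (t \o C) W).
    apply/matrixP => i j; rewrite !mxE /= -[LHS]/(metric (t (B i)) (W j) p) BC.
    by apply: eq_bigr => l _; rewrite !mxE.
  by rewrite det_mulmx detP mul0r.
pose x := (\row_j y j) *m invmx Pm.
exists (x 0) => V.
have -> : metric S V p = metric (t T) V p.
  apply/eqP; rewrite -subr_eq0; apply/eqP.
  by have := vST V; rewrite metricBl.
pose v : 'cV[R]_k := \col_j metric (t (C j)) V p.
rewrite TC; transitivity (((\row_j y j) *m v) 0 0).
  by rewrite mxE; apply: eq_bigr => i _; rewrite !mxE.
rewrite -(mulmxKV uP (\row_j y j)) -/x -mulmxA mxE.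
apply: eq_bigr => i _; congr (_ * _); rewrite mxE BC.
by apply: eq_bigr => l _; rewrite !mxE.
Qed.

(** Take sections [t (B i)] forming a basis of the image at p, and a Gram
    determinant D of theirs with D(p) <> 0. By Cramer's rule
    D S = sum_i c_i tau(B_i) at every point where D does not vanish, with
    smooth c_i; one more factor D makes the identity hold trivially at the
    zeros of D. This replaces the local frames and bump functions of the usual
    argument. *)
Lemma im_local_preimage t S p : S \in im_pred t ->
  exists f T, f p != 0 /\ f *: S = t T.
Proof.
move=> /asboolP imS; have [k rk] := tau_rank t.
have [B [freeB _]] := rk p.
have [W detW] := independent_gram k (t \o B) p freeB.
pose G := gram (t \o B) W; pose D := \det G.
pose c := (\row_j metric S (W j)) *m \adj G.
exists (D * D), (\sum_i (D * c 0 i) *: B i); split.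
  by rewrite -[(D * D) p]/(D p * D p) mulf_neq0.
apply/eqP; rewrite -subr_eq0; apply/eqP/vanishes_everywhere => q.
have -> : t (\sum_i (D * c 0 i) *: B i) = \sum_i (D * c 0 i) *: t (B i).
  by rewrite linear_sum; apply: eq_bigr => i _; rewrite linearZ.
apply/vanishes_atP => V; rewrite metricBl metricZl metric_suml.
under eq_bigr do rewrite -mulrA.
rewrite -mulr_sumr -mulrA -mulrBr -[LHS]/(D q * eval q _).
have [->|Dq] := eqVneq (D q) 0; first by rewrite mul0r.
have [T vT] := imS q.
have [x Sx] := coordinates_in_independent t k q B W S T (rk q) Dq vT.
(* The row of pairings of S is x times the Gram matrix at q, and a matrix
   times its adjugate is the scalar D q. *)
have cx i : c 0 i q = D q * x i.
  rewrite -[LHS]/(eval q _).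
  have -> : eval q (c 0 i) = map_mx (eval q) c 0 i by rewrite [RHS]mxE.
  have -> : map_mx (eval q) c = (\row_j x j) *m (D q)%:M.
    rewrite -[D q]/(eval q D) -det_map_mx -mul_mx_adj mulmxA map_mxM map_mx_adj.
    congr (_ *m _); apply/matrixP => i' j; rewrite !mxE.
    by rewrite -[LHS]/(metric S (W j) q) Sx; apply: eq_bigr => l _; rewrite !mxE.
  by rewrite mul_mx_scalar !mxE.
apply/eqP; rewrite mulf_eq0; apply/orP; right.
rewrite rmorphB subr_eq0 rmorphM [X in _ == X]rmorph_sum [X in _ * X == _]Sx.
rewrite mulr_sumr; apply/eqP; apply: eq_bigr => i _.
by rewrite rmorphM [X in _ = X * _]cx mulrA.
Qed.

(** * The Courant bracket *)

Lemma courantC S T : courant S T = - courant T S.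
Proof.
congr (_, _); first exact: lie_bracketC.
apply: one_formP => Z /=; rewrite !vfB; ring.
Qed.

Lemma courant2E S T Z : (courant S T).2 Z =
  S.1 (T.2 Z) - T.2 (lie_bracket S.1 Z) - T.1 (S.2 Z)
  + S.2 (lie_bracket T.1 Z) + const M 2^-1 * Z (S.2 T.1 - T.2 S.1).
Proof.
rewrite -[LHS]/(S.1 (T.2 Z) - T.2 (lie_bracket S.1 Z)
  - (T.1 (S.2 Z) - S.2 (lie_bracket T.1 Z))
  + const M 2^-1 * Z (S.2 T.1 - T.2 S.1)); ring.
Qed.

(** For arbitrary S and T there is a further term -1/2 g(S, T) df. *)
Lemma courantZr S T f : metric S T = 0 ->
  courant S (f *: T) = f *: courant S T + S.1 f *: T.
Proof.
move=> /eqP; rewrite /metric addr_eq0 => /eqP ST0.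
congr (_, _); first exact: lie_bracketZ.
apply: one_formP => Z.
rewrite -[RHS]/(f * (courant S T).2 Z + S.1 f * T.2 Z) !courant2E.
have E1 : (f *: T).1 = f *: T.1 by [].
have E2 V : (f *: T).2 V = f * T.2 V by [].
have E3 g : (f *: T.1) g = f * T.1 g by [].
rewrite E1 !E2 E3 lie_bracketZl formB !formZ !vfB !vfM ST0 !vfN.
have /eqP := const_half (Z f * T.2 S.1); rewrite -subr_eq0 => /eqP half.
by apply: subr0_eq; rewrite -oppr0 -half; ring.
Qed.

(** Invariance of the metric. The last line consists of the correction terms
    1/2 d g(S, T) and 1/2 d g(S, W) paired with [W] and [T]; they come from
    the skew-symmetrized form of the bracket. *)
Lemma courant_metric S T W :
  S.1 (metric T W) = metric (courant S T) W + metric T (courant S W)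
    + const M 2^-1 * (W.1 (metric S T) + T.1 (metric S W)).
Proof.
have E1 U V : (courant U V).1 = lie_bracket U.1 V.1 by [].
rewrite /metric !courant2E !E1 (lie_bracketC W.1) formN !(vfD, vfB, vfN).
have half f : const M 2^-1 * (f + f) - f = 0 by rewrite const_half subrr.
apply: subr0_eq; rewrite -oppr0 -(half (W.1 (S.2 T.1) + T.1 (S.2 W.1))).
ring.
Qed.

Lemma courantZl S T f : metric S T = 0 ->
  courant (f *: S) T = f *: courant S T - T.1 f *: S.
Proof.
rewrite metricC => TS0; rewrite courantC courantZr// (courantC S T).
by rewrite scalerN opprD.
Qed.

(** * Weak integrability *)

Lemma tau_im t S : t S \in im_pred t.
Proof.
by apply/asboolP => p; exists S; rewrite subrr; apply/vanishes_atP => W;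
  rewrite metric0l.
Qed.

Definition tau_section t S : im_sections t := ImSection (tau_im t S).

Lemma im_local t S : (forall p, exists f, f p != 0 /\ f *: S \in im_pred t) ->
  S \in im_pred t.
Proof.
move=> locS; apply/asboolP => p; have [f [fp /asboolP/(_ p)[T vT]]] := locS p.
exists (const M (f p)^-1 *: T); apply/vanishes_atP => W.
move/vanishes_atP : vT => /(_ W); rewrite linearZ !metricBl !metricZl => E.
rewrite -[LHS]/(metric S W p - (f p)^-1 * metric (t T) W p).
have -> : metric (t T) W p = f p * metric S W p.
  by apply/eqP; rewrite eq_sym -subr_eq0; apply/eqP.
by rewrite mulKf ?subrr.
Qed.

Lemma isotropic_im t S T : S \in im_pred t -> T \in im_pred t -> metric S T = 0.
Proof. by move=> iS iT; exact: (im_isotropic (ImSection iS) (ImSection iT)). Qed.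

(** For isotropic pairs, (f g) [S, T] differs from [f S, g T] by multiples of
    [S] and [T], so membership of [S, T] in E can be tested on the preimages
    given by [im_local_preimage]. *)
Lemma weakly_integrable_im t :
  (forall S T, courant (t S) (t T) \in im_pred t) -> weakly_integrable t.
Proof.
move=> inv S T iS iT; apply: im_local => p.
have [f [S' [fp fS]]] := im_local_preimage t S p iS.
have [g [T' [gp gT]]] := im_local_preimage t T p iT.
exists (f * g); split; first by rewrite -[(f * g) p]/(f p * g p) mulf_neq0.
have ST0 := isotropic_im t S T iS iT.
have -> : (f * g) *: courant S T = courant (f *: S) (g *: T)
    + (g * T.1 f) *: S - (f *: S).1 g *: T.
  rewrite courantZr; last by rewrite metricZl ST0 mulr0.
  rewrite courantZl// scalerBr !scalerA (mulrC g f).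
  by rewrite (addrAC _ _ ((g * T.1 f) *: S)) subrK addrK.
apply: rpredB; last exact: rpredZ.
apply: rpredD; last exact: rpredZ.
by rewrite fS gT; exact: inv.
Qed.

(** * The torsion and the differential of the associated form *)

Lemma metric_torsion t S T W :
  metric (torsion t S T) W = metric (courant (t S) (t T)) W
    + metric (courant S (t T)) (t W) + metric (courant (t S) T) (t W).
Proof.
rewrite /torsion tau_square addr0 !metricBl.
by rewrite ![metric (t (courant _ _)) _]tau_metric !opprK.
Qed.

Section LieAlgebroid.
Context {A : lie_algebroid M} (om : two_form A).
Implicit Types a b d : A.

Lemma la_differential_rot a b d :
  la_differential om a b d = la_differential om b d a.
Proof.
rewrite /la_differential (two_formC om a d) (two_formC om b a).
rewrite (la_bracketC b a) (la_bracketC d a).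
have omN x y : om (- x) y = - om x y.
  by rewrite two_formC -scaleN1r two_formZ (two_formC om x) mulN1r.
rewrite !omN !vfN; ring.
Qed.

(** Tensoriality in the last argument; [la_differential_rot] carries it to the
    other two. *)
Lemma la_differentialZ a b d f :
  la_differential om a b (f *: d) = f * la_differential om a b d.
Proof.
rewrite /la_differential !la_leibniz linearZ.
have omDl x y z : om (x + y) z = om x z + om y z.
  by rewrite two_formC two_formD (two_formC om x) (two_formC om y) opprD.
have omZl g x y : om (g *: x) y = g * om x y.
  by rewrite two_formC two_formZ (two_formC om x) mulrN.
rewrite !omDl !omZl !two_formZ !vfM (two_formC om d).
rewrite -[(f *: la_anchor A d) _]/(f * la_anchor A d _).
rewrite (two_formC om d a); ring.
Qed.
End LieAlgebroid.

Section Associated.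
Context {t : two_nilpotent M} {om : two_form (im_sections t)}.

Lemma associated_nondegenerate : associated_form om -> nondegenerate om.
Proof.
move=> hom p a a0; apply/vanishes_atP => W.
by rewrite -(hom a (tau_section t W) W).
Qed.

(** Invariance of the metric is used for the triples (tau S, T, tau W) and
    (tau T, S, tau W), in which the pairing of the two outer images vanishes
    by isotropy. *)
Lemma torsion_differential (hom : associated_form om)
    (wt : weakly_integrable t) S T W :
  metric (torsion t S T) W =
  - @la_differential R n M (im_algebroid wt) om
      (tau_section t S) (tau_section t T) (tau_section t W).
Proof.
have om_tau a U : om a (tau_section t U) = metric (val a) U by exact: hom.
rewrite /la_differential !om_tau metric_torsion.
set dom := (X in - X).
have -> : dom = (t S).1 (metric (t T) W) - (t T).1 (metric (t S) W)
    + (t W).1 (metric (t S) T) - metric (courant (t S) (t T)) W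
    + metric (courant (t S) (t W)) T - metric (courant (t T) (t W)) S by [].
have iso U V : metric (t U) (t V) = 0 by apply: isotropic_im; exact: tau_im.
have skew U V : metric U (t V) = - metric (t U) V by rewrite tau_metric opprK.
have := courant_metric (t S) T (t W).
have := courant_metric (t T) S (t W).
rewrite !iso !vf0 !addr0 (courantC (t T) S) metricNl.
rewrite (metricC (t T) S) !skew !vfN mulrN.
rewrite (metricC S (courant _ _)) (metricC T (courant _ _)).
have /eqP := const_half ((t W).1 (metric (t S) T)).
rewrite -subr_eq0 => /eqP half.
move=> /eqP; rewrite -subr_eq0 => /eqP eS /eqP; rewrite -subr_eq0 => /eqP eT.
(* The difference of the two sides is [eS - eT - half], with eS and eT the two
   instances of invariance and half the relation u/2 + u/2 = u for the
   derivative u of omega(tau S, tau T) along tau W. *)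
have zero : 0 - 0 - 0 = 0 :> smooth M by rewrite !subr0.
apply: subr0_eq; rewrite -[RHS]zero -[X in _ = X - _ - _]eS.
rewrite -[X in _ = _ - X - _]eT -[X in _ = _ - X]half; ring.
Qed.

(** Scaling each argument by a function that does not vanish at p brings it
    to the form tau S, and the differential at p is only multiplied by
    non-zero numbers. *)
Lemma tau_differential0 (wt : weakly_integrable t) :
  (forall S T W, @la_differential R n M (im_algebroid wt) om
     (tau_section t S) (tau_section t T) (tau_section t W) = 0) ->
  forall a b d, @la_differential R n M (im_algebroid wt) om a b d = 0.
Proof.
move=> d0 a b d; apply: smoothP => p.
have [f [S [fp fS]]] := im_local_preimage t (val a) p (valP a).
have [g [T [gp gT]]] := im_local_preimage t (val b) p (valP b).
have [h [W [hp hW]]] := im_local_preimage t (val d) p (valP d).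
have := d0 S T W.
have -> : tau_section t S = f *: a by apply/val_inj.
have -> : tau_section t T = g *: b by apply/val_inj.
have -> : tau_section t W = h *: d by apply/val_inj.
rewrite (@la_differentialZ (im_algebroid wt)) la_differential_rot.
rewrite (@la_differentialZ (im_algebroid wt)) la_differential_rot.
rewrite (@la_differentialZ (im_algebroid wt)) la_differential_rot.
set z := la_differential _ _ _ _; move=> /(congr1 (fun u : smooth M => u p)).
rewrite -[LHS]/(h p * (f p * (g p * z p))) -[RHS]/(0 : R) => /eqP.
by rewrite !mulf_eq0 (negPf fp) (negPf gp) (negPf hp) => /eqP.
Qed.
End Associated.
End GeneralizedNilpotent.

Theorem proposition4p1 (R : realType) (n : nat) (M : manifold R n)
    (t : two_nilpotent M) (om : two_form (im_sections t))
    (hom : associated_form om) :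
  integrable t <-> exists wt : weakly_integrable t, symplectic_form wt om.
Proof.
split=> [int|[wt [_ d0]] S T]; last first.
  apply: metric_inj => W.
  by rewrite (torsion_differential hom wt) d0 oppr0 metric0l.
have wt : weakly_integrable t.
  apply: weakly_integrable_im => S T; have := int S T.
  rewrite /torsion tau_square addr0 -addrA -opprD -linearD => /subr0_eq ->.
  exact: tau_im.
exists wt; split; first exact: associated_nondegenerate.
apply: tau_differential0 => S T W; apply: oppr_inj.
by rewrite -(torsion_differential hom wt) int metric0l oppr0.
Qed.
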